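(* Let $l\in\{3,\ldots,|T|\}$, let $L^p=\{1,\ldots,l_p\}$ with $1\le l_p\le l-2$, and let $S^p\subseteq L^p$. For each $w\in W$ let $L^w=\{l_p+1,\ldots,l_w\}$ with $l_p+1\le l_w\le l-1$, and $S^w\subseteq L^w$. For each $r\in R$, with $w=\delta_w(r)$ its warehouse, let $L^r=\{l_w+1,\ldots,l\}$ and $S^r\subseteq L^r$. Then the three-level inequality $$\sum_{k\in L^p\setminus S^p}x^p_k+\sum_{k\in S^p}d^p_{kl}\,y^p_k+\sum_{w\in W}\Big(\sum_{k\in L^w\setminus S^w}x^w_k+\sum_{k\in S^w}d^w_{kl}\,y^w_k\Big)+\sum_{r\in R}\Big(\sum_{k\in L^r\setminus S^r}x^r_k+\sum_{k\in S^r}d^r_{kl}\,y^r_k\Big)\ \ge\ d^p_{1l}$$ is valid for $X^{STD}$, i.e. it is satisfied by every $(x,s,y)\in X^{STD}$.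
   Context: Problem data (uncapacitated three-level lot-sizing and replenishment problem with a distribution structure). $T=\{1,\ldots,|T|\}$ is a finite set of consecutive periods. $F=P\cup W\cup R$ is a finite set of facilities (disjoint union), with $P=\{p\}$ (plant, level 0), $W$ the warehouses (level 1), $R$ the retailers (level 2). Each retailer $r\in R$ has a unique warehouse $\delta_w(r)\in W$; for $w\in W$, $\delta(w)=\{r\in R:\delta_w(r)=w\}$; and $\delta(p)=W$. Each retailer $r$ has demands $d^r_t\ge 0$, $t\in T$. Put $d^p_t=\sum_{r\in R}d^r_t$, $d^w_t=\sum_{r\in\delta(w)}d^r_t$ for $w\in W$, and for $i\in F$, $d^i_{kt}=\sum_{l=k}^{t}d^i_l$ for $1\le k\le t\le |T|$. $X^{STD}$ is the set of all $(x,s,y)$, with $x=(x^i_t)$, $s=(s^i_t)$, $y=(y^i_t)$ indexed by $i\in F$, $t\in T$, and with the convention $s^i_0=0$, satisfying: - $s^i_{t-1}+x^i_t=\sum_{j\in\delta(i)}x^j_t+s^i_t$ for $i\in P\cup W$, $t\in T$; - $s^r_{t-1}+x^r_t=d^r_t+s^r_t$ for $r\in R$, $t\in T$; - $x^i_t\le d^i_{t|T|}\,y^i_t$ for $i\in F$, $t\in T$; - $x^i_t,s^i_t\ge 0$ and $y^i_t\in\{0,1\}$ for $i\in F$, $t\in T$. *)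

(* Defs.v *)
From mathcomp Require Import all_boot all_order all_algebra.

Set Implicit Arguments.
Unset Strict Implicit.
Unset Printing Implicit Defensive.

Import Order.TTheory GRing.Theory Num.Theory.
Local Open Scope ring_scope.

(** Facilities F = P ∪ W ∪ R with P = {p}; the three sets are disjoint because
    the union is a sum type. *)
Definition facility (W R : finType) : finType := (unit + (W + R))%type.

Section Facilities.
Variables W R : finType.

Definition plant : facility W R := inl tt.
Definition warehouse (w : W) : facility W R := inr (inl w).
Definition retailer (r : R) : facility W R := inr (inr r).

Definition is_retailer (i : facility W R) : bool :=
  if i is inr (inr _) then true else false.

(** [dw r] is the warehouse serving retailer [r].  The value on retailers
    is never used. *)
Definition delta (dw : R -> W) (i : facility W R) : {set facility W R} :=
  match i with
  | inl _ => [set warehouse w | w : W]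
  | inr (inl w) => [set retailer r | r : R & dw r == w]
  | inr (inr _) => set0
  end.

End Facilities.

Arguments plant {W R}.
Arguments warehouse {W R} w.
Arguments retailer {W R} r.

Section LotSizing.
Variables (K : realFieldType) (W R : finType).
Variables (n : nat) (dw : R -> W) (d : R -> nat -> K).

(** Periods are the naturals t with 1 <= t <= n; families indexed by periods
    are functions on [nat] whose values outside this range are irrelevant
    (except for the stock at 0, see [X_s0]). *)
Definition demand (i : facility W R) (t : nat) : K :=
  match i with
  | inl _ => \sum_(r : R) d r t
  | inr (inl w) => \sum_(r : R | dw r == w) d r t
  | inr (inr r) => d r t
  end.

Definition cdemand (i : facility W R) (k t : nat) : K :=
  \sum_(k <= u < t.+1) demand i u.

Record XSTD (x s y : facility W R -> nat -> K) : Prop := {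
  X_s0 : forall i, s i 0%N = 0;
  X_balance : forall i t, ~~ is_retailer i -> (1 <= t <= n)%N ->
    s i t.-1 + x i t = \sum_(j in delta dw i) x j t + s i t;
  X_demand : forall r t, (1 <= t <= n)%N ->
    s (retailer r) t.-1 + x (retailer r) t = d r t + s (retailer r) t;
  X_setup : forall i t, (1 <= t <= n)%N -> x i t <= cdemand i t n * y i t;
  X_x_ge0 : forall i t, (1 <= t <= n)%N -> 0 <= x i t;
  X_s_ge0 : forall i t, (1 <= t <= n)%N -> 0 <= s i t;
  X_y_bin : forall i t, (1 <= t <= n)%N -> y i t = 0 \/ y i t = 1
}.

End LotSizing.

(* Main.v *)
(** Fix one facility. Until the first period of S with a set-up, every period
    of S contributes nothing to production, so its part of the left-hand side
    dominates the production of its block; a set-up in period k of S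
    contributes the whole demand of periods k to l, and production before k
    covers the demand before k. So each facility either covers all of its own
    demand up to l, or has at least the production of its block on the
    left-hand side; in the latter case this production, together with that of
    the preceding blocks, is passed down to the successors by flow
    conservation. At the retailers both alternatives cover the demand. *)

Require Import Defs.
From mathcomp Require Import all_boot all_order all_algebra.

Set Implicit Arguments.
Unset Strict Implicit.
Unset Printing Implicit Defensive.

Import Order.TTheory GRing.Theory Num.Theory.
Local Open Scope ring_scope.

(** * One facility in isolation: its block of periods and its stock balance *)

Section Levels.
Variable K : realFieldType.

(** Blocks are half-open, so the block of the next level starts at the same [b]. *)
Definition level_lhs (S : {pred nat}) (x D y : nat -> K) (a b : nat) : K :=
  \sum_(a <= k < b | k \notin S) x k + \sum_(a <= k < b | k \in S) D k * y k.

Lemma level_lhs_recr (S : {pred nat}) (x D y : nat -> K) (a b : nat) :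
  (a <= b)%N ->
  level_lhs S x D y a b.+1 =
  level_lhs S x D y a b + (if b \in S then D b * y b else x b).
Proof.
move=> ab; rewrite /level_lhs !(big_mkcond (fun _ => _ \in _)).
rewrite !(big_mkcond (fun _ => _ \notin _)) !(big_nat_recr b) //=.
by rewrite addrACA; case: (b \in S); rewrite /= ?add0r ?addr0.
Qed.

Lemma level_lhs_ge0 (S : {pred nat}) (x D y : nat -> K) (a b : nat) :
  (forall k, (a <= k < b)%N -> [/\ 0 <= x k, 0 <= D k & 0 <= y k]) ->
  0 <= level_lhs S x D y a b.
Proof.
move=> h; rewrite /level_lhs addr_ge0 // big_nat_cond sumr_ge0 // => k.
  by case/andP=> /h[].
by case/andP=> /h[_ D0 y0] _; rewrite mulr_ge0.
Qed.

(** Induction on the end of the block. The first alternative persists until a period of [S] with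
    [y = 1]; the second, once reached, is kept because later terms are nonnegative. *)
Lemma level_lhs_cover (S : {pred nat}) (x y g : nat -> K) (a b l : nat) :
  (0 < a <= b)%N -> (b <= l.+1)%N ->
  (forall k, (0 < k <= l)%N -> 0 <= g k) ->
  (forall t, (t <= l)%N ->
     \sum_(1 <= k < t.+1) g k <= \sum_(1 <= k < t.+1) x k) ->
  (forall k, (0 < k <= l)%N -> 0 <= x k) ->
  (forall k, (0 < k <= l)%N -> y k = 0 -> x k <= 0) ->
  (forall k, (0 < k <= l)%N -> y k = 0 \/ y k = 1) ->
  let lhs := \sum_(1 <= k < a) x k
             + level_lhs S x (fun k => \sum_(k <= u < l.+1) g u) y a b in
  \sum_(1 <= k < b) x k <= lhs \/ \sum_(1 <= k < l.+1) g k <= lhs.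
Proof.
move=> /andP[a0 ab] bl g0 cov x_ge0 x_le0 y01 /=.
have g_sum_ge0 k : (0 < k)%N -> 0 <= \sum_(k <= u < l.+1) g u.
  move=> k0; rewrite big_nat sumr_ge0 // => u /andP[ku ul].
  by rewrite g0 // (leq_trans k0 ku).
elim: b ab bl => [|b IH]; first by rewrite leqn0 => /eqP a_eq0; rewrite a_eq0 in a0.
rewrite leq_eqVlt => /predU1P[<- _|].
  by left; rewrite /level_lhs !(@big_geq _ _ _ a a) // !addr0.
rewrite ltnS => ab bl.
have b0 : (0 < b)%N by apply: leq_trans ab.
have bin : (0 < b <= l)%N by rewrite b0.
rewrite level_lhs_recr // addrA (big_nat_recr b) //=.
set A := _ + level_lhs _ _ _ _ _ _ in IH *.
have {IH}[IH|IH] : _ \/ _ := IH ab (ltnW bl).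
- case: ifP => bS; last by left; rewrite lerD2r.
  case: (y01 b bin) => yb; rewrite yb; last first.
    (* The set-up term is the demand of periods [b] to [l]; production through [b.-1] covers the
       rest. *)
    right; rewrite mulr1 (big_cat_nat b0 (ltnW bl)) /= lerD2r.
    by rewrite (le_trans _ IH) // -(prednK b0) cov // (leq_trans (leq_pred b)).
  by left; rewrite mulr0 lerD // x_le0.
- right; rewrite (le_trans IH) // lerDl; case: ifP => _; last exact: x_ge0.
  by rewrite mulr_ge0 ?g_sum_ge0 //; case: (y01 b bin) => ->.
Qed.

(** Telescoping from zero initial stock. The outflow [o] is the successors' intake at the plant and
    the warehouses, the demand at a retailer. *)
Lemma stock_balance_sum (n : nat) (s x o : nat -> K) :
  s 0%N = 0 ->
  (forall t, (1 <= t <= n)%N -> s t.-1 + x t = o t + s t) ->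
  forall t, (t <= n)%N ->
  \sum_(1 <= k < t.+1) x k = \sum_(1 <= k < t.+1) o k + s t.
Proof.
move=> s0 bal; elim=> [_|t IH tn]; first by rewrite !big_geq // s0 addr0.
rewrite !(big_nat_recr t.+1) //= IH ?(ltnW tn) // -addrA.
by rewrite (bal t.+1) // addrA.
Qed.

End Levels.

(** * Flow between the levels and coverage of demand *)

Section Validity.
Variables (K : realFieldType) (W R : finType).
Variables (n : nat) (dw : R -> W) (d : R -> nat -> K).
Variables (x s y : facility W R -> nat -> K).

Lemma cdemand_warehouse (w : W) (k t : nat) :
  cdemand dw d (warehouse w) k t =
  \sum_(r : R | dw r == w) cdemand dw d (retailer r) k t.
Proof. by rewrite /cdemand exchange_big. Qed.

Lemma cdemand_plant (k t : nat) :
  cdemand dw d plant k t = \sum_(w : W) cdemand dw d (warehouse w) k t.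
Proof.
rewrite /cdemand [RHS]exchange_big; apply: eq_bigr => u _ /=.
by rewrite (partition_big dw predT).
Qed.

Lemma demand_ge0 (i : facility W R) (t : nat) :
  (forall r, 0 <= d r t) -> 0 <= demand dw d i t.
Proof. by move=> h; case: i => [u|[w|r]] /=; rewrite ?sumr_ge0. Qed.

Hypothesis hX : XSTD n dw d x s y.

Lemma stock_ge0 (i : facility W R) (t : nat) : (t <= n)%N -> 0 <= s i t.
Proof.
case: t => [|t] tn; first by rewrite (X_s0 hX).
by rewrite (X_s_ge0 hX).
Qed.

(** The two sides differ by the plant's closing stock, which is nonnegative. *)
Lemma plant_flow (t : nat) : (t <= n)%N ->
  \sum_(w : W) \sum_(1 <= k < t.+1) x (warehouse w) k
    <= \sum_(1 <= k < t.+1) x plant k.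
Proof.
move=> tn; pose o u := \sum_(w : W) x (warehouse w) u.
have bal u : (1 <= u <= n)%N -> s plant u.-1 + x plant u = o u + s plant u.
  move=> un; rewrite (X_balance hX) // big_imset //=.
  by move=> v w _ _ [].
rewrite exchange_big (stock_balance_sum (X_s0 hX plant) bal tn) lerDl.
exact: stock_ge0.
Qed.

Lemma warehouse_flow (w : W) (t : nat) : (t <= n)%N ->
  \sum_(r : R | dw r == w) \sum_(1 <= k < t.+1) x (retailer r) k
    <= \sum_(1 <= k < t.+1) x (warehouse w) k.
Proof.
move=> tn; pose o u := \sum_(r : R | dw r == w) x (retailer r) u.
have bal u : (1 <= u <= n)%N ->
    s (warehouse w) u.-1 + x (warehouse w) u = o u + s (warehouse w) u.
  move=> un; rewrite (X_balance hX) // big_imset /=; last by move=> q r _ _ [].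
  by congr (_ + _); apply: eq_bigl => r; rewrite inE.
rewrite exchange_big (stock_balance_sum (X_s0 hX _) bal tn) lerDl.
exact: stock_ge0.
Qed.

(** Proved upwards: retailers by their balance, then warehouses and plant by the flow bounds. *)
Lemma cdemand_le_production (i : facility W R) (t : nat) : (t <= n)%N ->
  cdemand dw d i 1 t <= \sum_(1 <= k < t.+1) x i k.
Proof.
move=> tn.
have hr r : cdemand dw d (retailer r) 1 t <= \sum_(1 <= k < t.+1) x (retailer r) k.
  rewrite (stock_balance_sum (X_s0 hX (retailer r)) (X_demand hX r) tn) lerDl.
  exact: stock_ge0.
have hw w : cdemand dw d (warehouse w) 1 t
    <= \sum_(1 <= k < t.+1) x (warehouse w) k.
  by rewrite cdemand_warehouse (le_trans _ (warehouse_flow w tn)) ?ler_sum.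
case: i => [[]|[w|r]]; [|exact: hw|exact: hr].
by rewrite -/plant cdemand_plant (le_trans _ (plant_flow tn)) ?ler_sum.
Qed.

Hypothesis d_ge0 : forall r t, (1 <= t <= n)%N -> 0 <= d r t.
Variable l : nat.
Hypothesis ln : (l <= n)%N.

Definition facility_lhs (S : {pred nat}) (i : facility W R) (a b : nat) : K :=
  level_lhs S (x i) (fun k => cdemand dw d i k l) (y i) a b.

Lemma period_le_n (k : nat) : (0 < k <= l)%N -> (1 <= k <= n)%N.
Proof. by case/andP=> -> kl; rewrite (leq_trans kl ln). Qed.

Lemma facility_lhs_ge0 (S : {pred nat}) (i : facility W R) (a b : nat) :
  (0 < a)%N -> (b <= l.+1)%N -> 0 <= facility_lhs S i a b.
Proof.
move=> a0 bl; apply: level_lhs_ge0 => k /andP[ak kb].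
have k0 : (0 < k)%N by apply: leq_trans ak.
have kn : (1 <= k <= n)%N by rewrite period_le_n // k0 -ltnS (leq_trans kb bl).
split; first exact: (X_x_ge0 hX).
  rewrite /cdemand big_nat sumr_ge0 // => u /andP[ku ul].
  apply: demand_ge0 => r; apply: d_ge0.
  by rewrite period_le_n // (leq_trans k0 ku).
by case: (X_y_bin hX i kn) => ->.
Qed.

Lemma facility_lhs_cover (S : {pred nat}) (i : facility W R) (a b : nat) :
  (0 < a <= b)%N -> (b <= l.+1)%N ->
  let lhs := \sum_(1 <= k < a) x i k + facility_lhs S i a b in
  \sum_(1 <= k < b) x i k <= lhs \/ cdemand dw d i 1 l <= lhs.
Proof.
move=> ab bl; apply: level_lhs_cover => // [k /period_le_n kn|t tl|k /period_le_n kn|k /period_le_n kn yk|k /period_le_n kn].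
- by apply: demand_ge0 => r; apply: d_ge0.
- by apply: cdemand_le_production; apply: leq_trans ln.
- exact: (X_x_ge0 hX).
(* The set-up bound counts demand up to [n] rather than [l], but it vanishes with [y]. *)
- by rewrite (le_trans (X_setup hX i kn)) // yk mulr0.
- exact: (X_y_bin hX).
Qed.

(** The block ends at [l], so even the first alternative gives production through [l], which covers
    the demand. *)
Lemma retailer_cover (S : {pred nat}) (r : R) (a : nat) :
  (0 < a <= l.+1)%N ->
  cdemand dw d (retailer r) 1 l
    <= \sum_(1 <= k < a) x (retailer r) k + facility_lhs S (retailer r) a l.+1.
Proof.
move=> al; case: (facility_lhs_cover S (retailer r) al (leqnn _)) => //.
exact/le_trans/cdemand_le_production.
Qed.

(** If the warehouse alone covers its demand, the retailer terms are dropped as nonnegative.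
    Otherwise its production before [b] bounds what its retailers receive before their common start
    [b]. *)
Lemma warehouse_cover (S : {pred nat}) (Sr : R -> {pred nat}) (w : W)
    (a b : nat) :
  (0 < a <= b)%N -> (b <= l.+1)%N ->
  cdemand dw d (warehouse w) 1 l
    <= \sum_(1 <= k < a) x (warehouse w) k + facility_lhs S (warehouse w) a b
       + \sum_(r : R | dw r == w) facility_lhs (Sr r) (retailer r) b l.+1.
Proof.
move=> ab bl; have b0 : (0 < b)%N by case/andP: ab; apply: leq_trans.
case: (facility_lhs_cover S (warehouse w) ab bl) => [|cov]; last first.
  rewrite (le_trans cov) // lerDl sumr_ge0 // => r _.
  exact: facility_lhs_ge0.
(* Adds the retailer terms to both sides of the first alternative, so that transitivity applies. *)
rewrite -(lerD2r (\sum_(r : R | dw r == w) facility_lhs (Sr r) (retailer r) b l.+1)).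
apply: le_trans; rewrite cdemand_warehouse.
have flow : \sum_(r : R | dw r == w) \sum_(1 <= k < b) x (retailer r) k
    <= \sum_(1 <= k < b) x (warehouse w) k.
  by rewrite -(prednK b0) warehouse_flow // (leq_trans _ ln) // -ltnS prednK.
apply: le_trans (lerD flow (lexx _)); rewrite -big_split /=.
by apply: ler_sum => r _; apply: retailer_cover; rewrite b0.
Qed.

End Validity.

Theorem proposition3 (K : realFieldType) (W R : finType)
    (n : nat) (dw : R -> W) (d : R -> nat -> K)
    (d_ge0 : forall r t, (1 <= t <= n)%N -> 0 <= d r t)
    (l : nat) (hl : (3 <= l <= n)%N)
    (lp : nat) (hlp : (1 <= lp <= l - 2)%N)
    (Sp : {pred nat}) (hSp : forall k, k \in Sp -> (1 <= k <= lp)%N)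
    (lw : W -> nat) (hlw : forall w, (lp.+1 <= lw w <= l - 1)%N)
    (Sw : W -> {pred nat})
    (hSw : forall w k, k \in Sw w -> (lp.+1 <= k <= lw w)%N)
    (Sr : R -> {pred nat})
    (hSr : forall r k, k \in Sr r -> ((lw (dw r)).+1 <= k <= l)%N)
    (x s y : facility W R -> nat -> K) (hX : XSTD n dw d x s y) :
  \sum_(1 <= k < lp.+1 | k \notin Sp) x plant k
  + \sum_(1 <= k < lp.+1 | k \in Sp) cdemand dw d plant k l * y plant k
  + \sum_(w : W)
      (\sum_(lp.+1 <= k < (lw w).+1 | k \notin Sw w) x (warehouse w) k
       + \sum_(lp.+1 <= k < (lw w).+1 | k \in Sw w)
           cdemand dw d (warehouse w) k l * y (warehouse w) k)
  + \sum_(r : R)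
      (\sum_((lw (dw r)).+1 <= k < l.+1 | k \notin Sr r) x (retailer r) k
       + \sum_((lw (dw r)).+1 <= k < l.+1 | k \in Sr r)
           cdemand dw d (retailer r) k l * y (retailer r) k)
  >= cdemand dw d plant 1 l.
Proof.
have /andP[l3 ln] := hl; have /andP[lp1 lpl] := hlp.
have lpl' : (lp.+1 <= l.+1)%N by rewrite ltnS (leq_trans lpl) ?leq_subr.
have hw w : (0 < lp.+1 <= (lw w).+1)%N by have /andP[/ltnW] := hlw w.
have lwl w : ((lw w).+1 <= l.+1)%N.
  by have /andP[_ h] := hlw w; rewrite ltnS (leq_trans h) ?leq_subr.
pose Lhs := facility_lhs dw d x y l.
change (cdemand dw d plant 1 l <=
  Lhs Sp plant 1%N lp.+1
  + \sum_(w : W) Lhs (Sw w) (warehouse w) lp.+1 (lw w).+1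
  + \sum_(r : R) Lhs (Sr r) (retailer r) (lw (dw r)).+1 l.+1).
(* The plant's block starts at 1, so the sum of earlier production is empty. *)
case: (facility_lhs_cover hX d_ge0 ln Sp plant (isT : (0 < 1 <= lp.+1)%N) lpl');
  rewrite (@big_geq _ _ _ 1 1) // add0r -/Lhs => cov; last first.
  rewrite (le_trans cov) // -addrA lerDl addr_ge0 // sumr_ge0 // => i _;
  exact: (facility_lhs_ge0 hX d_ge0 ln).
have flow := le_trans (plant_flow hX (leq_trans (lpl' : (lp <= l)%N) ln)) cov.
rewrite -addrA; apply: le_trans (lerD flow (lexx _)); rewrite addrA.
(* Grouping retailers by warehouse reduces the claim to one inequality per warehouse. *)
rewrite (partition_big dw predT) //= -!big_split /= cdemand_plant.
apply: ler_sum => w _.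
(* Within the group of [w], all retailer blocks have the common start that [warehouse_cover]
   requires. *)
rewrite (eq_bigr (fun r => Lhs (Sr r) (retailer r) (lw w).+1 l.+1)).
  exact: (warehouse_cover hX d_ge0 ln).
by move=> r /eqP <-.
Qed.
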